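(* Let $\Phi$ and $\Psi$ be two sets of Sudoku propositions. If $\Phi \models \Psi$ then $\Phi \vdash \Psi$.
   Context: A Sudoku proposition is a formal symbol $r_ic_j \not\approx d$ with $i,j,d\in\{1,\dots,9\}$. Sudoku formulas are built inductively from Sudoku propositions and the constants $\top,\bot$ using $\lnot,\land,\lor,\Rightarrow,\Leftrightarrow$. A grid is a $9\times 9$ matrix $\mathcal{A}=[A_{ij}]_{9\times 9}$ of nonempty subsets $A_{ij}\subseteq\{1,\dots,9\}$; it is full if $|A_{ij}|=1$ for all $i,j$. Satisfaction $\mathcal{A}\models\phi$: $\mathcal{A}\models\top$ always, $\mathcal{A}\models\bot$ never, $\mathcal{A}\models r_ic_j\not\approx d$ iff $d\notin A_{ij}$, and the connectives are interpreted classically (two-valued truth tables). For a set $\Phi$ of formulas, $\mathcal{A}\models\Phi$ means $\mathcal{A}\models\phi$ for all $\phi\in\Phi$. Write $r_ic_j\equiv d$ for $\bigwedge_{s\ne d} r_ic_j\not\approx s$, and $r_ic_j\parallel r_\ell c_m$ for $\bigwedge_{1\le d\le 9}((r_ic_j\equiv d\Rightarrow r_\ell c_m\not\approx d)\land(r_\ell c_m\equiv d\Rightarrow r_ic_j\not\approx d))$. The set $\Sigma_{ax}$ consists of 27 formulas, one for each row, each column and each of the nine standard $3\times 3$ boxes: the conjunction of $r_ic_j\parallel r_\ell c_m$ over all pairs of distinct cells in that row, column or box. A Sudoku grid is a grid $\mathcal{A}$ with $\mathcal{A}\models\Sigma_{ax}$ (i.e. whenever $A_{ij}=\{d\}$,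 $d$ belongs to no $A_{\ell m}$ for another cell in the same row, column or box). A full Sudoku grid is a Sudoku grid that is full. A Sudoku axiom is a Sudoku formula that holds in every full Sudoku grid; $\Delta_{ax}$ is the set of all Sudoku axioms. For a set $\Phi$ of Sudoku formulas and a Sudoku formula $\alpha$, $\Phi\vdash\alpha$ means there is a finite sequence $\phi_1,\dots,\phi_n=\alpha$ of Sudoku formulas such that each $\phi_i$ is in $\Delta_{ax}$, or in $\Phi$, or is obtained by modus ponens from earlier formulas (there are $p,q<i$ with $\phi_q$ equal to $\phi_p\Rightarrow\phi_i$). $\Phi\vdash\Psi$ means $\Phi\vdash\alpha$ for all $\alpha\in\Psi$. A grid $\mathcal{S}=[S_{ij}]$ is a solution of a grid $\mathcal{A}=[A_{ij}]$ if $\mathcal{S}$ is full and $S_{ij}\subseteq A_{ij}$ for all $i,j$. For sets $\Phi,\Psi$ of Sudoku propositions, $\Phi\models\Psi$ means: for every Sudoku grid $\mathcal{A}$ with $\mathcal{A}\models\Phi$, and every full Sudoku grid $\mathcal{S}$ which is a solution of $\mathcal{A}$, $\mathcal{S}\models\Psi$. *)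

(* Defs.v *)
From mathcomp Require Import all_boot all_order all_algebra.
From mathcomp Require Import classical_sets.

Set Implicit Arguments.
Unset Strict Implicit.
Unset Printing Implicit Defensive.

(* Rows, columns and digits 1, ..., 9 are represented by 'I_9, shifted by 1. *)

Inductive formula : Type :=
| Neq of 'I_9 & 'I_9 & 'I_9  (* [Neq i j d] is the proposition r_i c_j !~ d *)
| Top
| Bot
| Neg of formula
| And of formula & formula
| Or of formula & formula
| Imp of formula & formula
| Iff of formula & formula.

Definition is_proposition (phi : formula) : Prop :=
  exists i j d : 'I_9, phi = Neq i j d.

Record grid := Grid {
  entries :> 'M[{set 'I_9}]_9;
  entries_neq0 : forall i j, entries i j != finset.set0
}.

Definition full (A : grid) : Prop := forall i j, #|A i j| = 1.

Fixpoint sat (A : grid) (phi : formula) : bool :=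
  match phi with
  | Neq i j d => d \notin A i j
  | Top => true
  | Bot => false
  | Neg a => ~~ sat A a
  | And a b => sat A a && sat A b
  | Or a b => sat A a || sat A b
  | Imp a b => sat A a ==> sat A b
  | Iff a b => sat A a == sat A b
  end.

Definition sat_set (A : grid) (Phi : set formula) : Prop :=
  forall phi, Phi phi -> sat A phi.

Definition cell : Type := 'I_9 * 'I_9.

Definition cell_eq (c : cell) (d : 'I_9) : formula :=
  \big[And/Top]_(s : 'I_9 | s != d) Neq c.1 c.2 s.

Definition parallel (c c' : cell) : formula :=
  \big[And/Top]_(d : 'I_9)
    And (Imp (cell_eq c d) (Neq c'.1 c'.2 d))
        (Imp (cell_eq c' d) (Neq c.1 c.2 d)).

Inductive house : Type := Row of 'I_9 | Column of 'I_9 | Box of 'I_9.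

Definition in_house (h : house) (c : cell) : bool :=
  match h with
  | Row i => c.1 == i
  | Column j => c.2 == j
  | Box b => 3 * (c.1 %/ 3) + c.2 %/ 3 == b
  end.

Definition house_formula (h : house) : formula :=
  \big[And/Top]_(p : cell * cell |
      [&& in_house h p.1, in_house h p.2 & p.1 != p.2])
    parallel p.1 p.2.

Definition Sigma_ax : set formula := range house_formula.

Definition sudoku (A : grid) : Prop := sat_set A Sigma_ax.

Definition Delta_ax : set formula :=
  fun phi => forall A : grid, sudoku A -> full A -> sat A phi.

Definition derivation (Phi : set formula) (s : seq formula) : Prop :=
  forall i, i < size s ->
    [\/ Delta_ax (nth Top s i),
        Phi (nth Top s i)
      | exists p q, [/\ p < i, q < i &
          nth Top s q = Imp (nth Top s p) (nth Top s i)]].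

Definition derives (Phi : set formula) (alpha : formula) : Prop :=
  exists s : seq formula, derivation Phi (rcons s alpha).

Definition derives_set (Phi Psi : set formula) : Prop :=
  forall alpha, Psi alpha -> derives Phi alpha.

Definition solution (S A : grid) : Prop :=
  full S /\ forall i j, S i j \subset A i j.

Definition entails (Phi Psi : set formula) : Prop :=
  forall A : grid, sudoku A -> sat_set A Phi ->
  forall S : grid, full S -> sudoku S -> solution S A -> sat_set S Psi.

(* Main.v *)
Require Import Defs.
From mathcomp Require Import all_boot all_order all_algebra.
From mathcomp Require Import boolp classical_sets.

(** A full Sudoku grid is a solution of itself, so [entails Phi Psi] says that
  every full Sudoku grid satisfying [Phi] satisfies [Psi]. There are only 729
  Sudoku propositions, so [Phi] is finite, say [phi_1, ..., phi_n], and for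
  [psi] in [Psi] the formula [phi_1 => ... => phi_n => psi] is a Sudoku axiom;
  [psi] follows by [n] applications of modus ponens. *)

(** Modus ponens refers to its premises by position: positions in [s] are unchanged, and those in
    [t] are all shifted by [size s]. *)
Lemma derivation_cat (Phi : set formula) (s t : seq formula) :
  derivation Phi s -> derivation Phi t -> derivation Phi (s ++ t).
Proof.
move=> ds dt i; rewrite size_cat nth_cat => lt_i.
case: ltnP => [lt_is | le_si].
  have [ax | hyp | [p [q [lt_pi lt_qi mp]]]] := ds i lt_is.
  - exact: Or31.
  - exact: Or32.
  - apply: Or33; exists p, q; split=> //.
    by rewrite !nth_cat (ltn_trans lt_pi lt_is) (ltn_trans lt_qi lt_is).
have lt_it : i - size s < size t by rewrite ltn_subLR.
have [ax | hyp | [p [q [lt_pi lt_qi mp]]]] := dt _ lt_it.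
- exact: Or31.
- exact: Or32.
- apply: Or33; exists (size s + p), (size s + q).
  by rewrite -!ltn_subRL !nth_cat !ltnNge !leq_addr /= !addKn -!ltnNge.
Qed.

Lemma derives_mp (Phi : set formula) (a b : formula) :
  derives Phi (Imp a b) -> derives Phi a -> derives Phi b.
Proof.
move=> [s ds] [t dt]; have dst := derivation_cat _ _ _ ds dt.
exists (rcons s (Imp a b) ++ rcons t a) => i.
rewrite size_rcons ltnS leq_eqVlt => /predU1P[-> | lt_i].
  (* The new last formula is [b]. Its premise [a] ends [u], at position [p], and [Imp a b] closes
     the first block, at position [size s]. *)
  set u := _ ++ _; pose p := (size s).+1 + size t.
  have lt_p : p < size u by rewrite size_cat !size_rcons ltn_add2l.
  have lt_q : size s < size u by rewrite size_cat size_rcons addSn ltnS leq_addr.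
  apply: Or33; exists p, (size s); split=> //.
  rewrite !nth_rcons lt_p lt_q ltnn eqxx !nth_cat !size_rcons ltnSn.
  by rewrite ltnNge leq_addr /= addKn !nth_rcons !ltnn !eqxx.
have [ax | hyp | [p [q [lt_pi lt_qi mp]]]] := dst i lt_i.
- by apply: Or31; rewrite nth_rcons lt_i.
- by apply: Or32; rewrite nth_rcons lt_i.
- apply: Or33; exists p, q; split=> //.
  by rewrite !nth_rcons lt_i (ltn_trans lt_pi lt_i) (ltn_trans lt_qi lt_i).
Qed.

Lemma derives_axiom (Phi : set formula) (a : formula) :
  Delta_ax a -> derives Phi a.
Proof. by move=> ax; exists [::]; case=> // _; apply: Or31. Qed.

Lemma derives_hyp (Phi : set formula) (a : formula) : Phi a -> derives Phi a.
Proof. by move=> hyp; exists [::]; case=> // _; apply: Or32. Qed.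

(** Triples form a finite type, unlike [formula], so the propositions in [Phi] can be enumerated
    through them. *)
Definition proposition (t : 'I_9 * 'I_9 * 'I_9) : formula :=
  Neq t.1.1 t.1.2 t.2.

Definition imps (l : seq ('I_9 * 'I_9 * 'I_9)) (a : formula) : formula :=
  foldr (fun t => Imp (proposition t)) a l.

Lemma sat_imps (A : grid) l (a : formula) :
  sat A (imps l a) = (all (fun t => sat A (proposition t)) l ==> sat A a).
Proof. by elim: l => //= t l ->; case: (_ \notin _). Qed.

(** Each modus ponens with a member of [Phi] strips the outermost premise, the head of [l]. *)
Lemma derives_imps (Phi : set formula) l (a : formula) :
  {in l, forall t, Phi (proposition t)} -> derives Phi (imps l a) ->
  derives Phi a.
Proof.
elim: l => //= t l IHl hyps d; apply: IHl => [u lu|].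
  by apply: hyps; rewrite inE lu orbT.
by apply: derives_mp d (derives_hyp _ _ (hyps t (mem_head _ _))).
Qed.

Lemma entails_sat (Phi Psi : set formula) (S : grid) :
  entails Phi Psi -> sudoku S -> full S -> sat_set S Phi -> sat_set S Psi.
Proof. by move=> ent sS fS SPhi; apply: (ent S sS SPhi S). Qed.

Theorem theorem5p4 (Phi Psi : set formula)
  (hPhi : forall phi, Phi phi -> is_proposition phi)
  (hPsi : forall psi, Psi psi -> is_proposition psi) :
  entails Phi Psi -> derives_set Phi Psi.
Proof.
move=> ent psi Psi_psi.
(* Membership in [Phi] is an arbitrary [Prop]; classical logic turns it into a boolean test for the
   filter. *)
pose l := [seq t <- enum {: 'I_9 * 'I_9 * 'I_9} | `[< Phi (proposition t) >]].
apply: (derives_imps _ l) => [t|].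
  by rewrite mem_filter => /andP[/asboolP].
apply: derives_axiom => S sS fS; rewrite sat_imps; apply/implyP => /allP Sl.
apply: (entails_sat _ _ _ ent) => // phi Phi_phi.
(* Being a proposition, [phi] comes from a triple, which the filter keeps in [l]; all of [l] holds
   in [S]. *)
have [i [j [d def_phi]]] := hPhi _ Phi_phi; subst phi.
by apply: (Sl (i, j, d)); rewrite mem_filter mem_enum andbT; apply/asboolP.
Qed.
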